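(* Let $\phi$ be a boundary function. Then the boundary function for the ideal set $\sigma[\phi]$ is $\phi$, and the boundary function for the ideal set $\sigma(\phi)$ is $\phi^-$.
   Context: Setting. $X$ is a Cantor space. $G\subseteq X\times X$ is the groupoid (spectrum) of a simple AF C*-algebra $B$ relative to a canonical masa $D\cong C(X)$: $G$ is an equivalence relation on $X$, equal to the union of the graphs of the partial homeomorphisms of $X$ induced by the matrix units of a matrix unit system for $B$. $G$ is a principal groupoid with product $(w,x)\circ(x,z)=(w,z)$ and inverse $(w,x)^{-1}=(x,w)$, and is a topological groupoid in the topology generated by declaring these graphs open (each graph is also compact; this topology is in general not the relative product topology). The map $x\mapsto(x,x)$ is a homeomorphism of $X$ onto an open compact subset of $G$, and $X$ is identified with this diagonal. The coordinate projections $\pi_1,\pi_2$ restricted to $G$ are local homeomorphisms. A $G$-set is an open set on which $\pi_1$ and $\pi_2$ are one-to-one; neighborhoods of points of $G$ are always taken to be $G$-sets. Each equivalence class $\operatorname{orb}_y=\{x: (x,y)\in G\}$ is countable and dense in $X$. There is a continuous injective function $b:X\to\mathbb{R}$, and $P=\{(x,y)\in G: b(x)\le b(y)\}$ (the spectrum of a trivially analytic subalgebra $A\subseteq B$); $P$ is open in $G$, $P\circ P\subseteq P$, $P\cap P^{-1}=X$, $P\cup P^{-1}=G$. The total order on $X$ is $x\preceq y\iff b(x)\le b(y)$; its order topology is the original topology of $X$, and it agrees with $P$ on each equivalence class. $X$ has a minimal element $p_{\min}$ and a maximal element $p_{\max}$. Sups and infs are taken in $(X,\preceq)$ (so $\sup\emptyset=p_{\min}$).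 If $x\prec y$ and the open order interval with endpoints $x,y$ is empty, then $x$ has a gap above, $y$ has a gap below, $x=\operatorname{pred}y$, $y=\operatorname{succ}x$. An ideal set is an open subset $\sigma$ of $P$ such that $(w,x),(y,z)\in P$ and $(x,y)\in\sigma$ imply $(w,z)\in\sigma$. The boundary function for an ideal set $\sigma$ is $\phi_\sigma:X\to X$, $\phi_\sigma(y)=\sup\{x\in\operatorname{orb}_y:(x,y)\in\sigma\}$. A boundary function is a function $\phi:X\to X$ such that: (1) $\phi(y)\preceq y$ for all $y$; (2) whenever $\phi(y)$ has a gap below: (a) $(\phi(y),y)\in P$, (b) $y$ has a gap below, (c) $y\prec z$ implies $\phi(y)\prec\phi(z)$, (d) there is a neighborhood $N$ of $(\phi(y),y)$ such that $(s,t)\in N$ implies $s\preceq\phi(t)$; (3) $y\prec z$ implies $\phi(y)\preceq\phi(z)$; (4) if $y$ does not have a gap below, then $\phi(y)=\sup\{\phi(t): t\prec y\}$. For a boundary function $\phi$: $\sigma(\phi)=\{(x,y)\in P: x\prec\phi(y)\}$; $\eta(\phi)=\{(x,y)\in P: x\preceq\phi(y)\}$; $\sigma[\phi]=\{(x,y)\in P:\text{there is a neighborhood }N\text{ of }(x,y)\text{ with }N\subseteq\eta(\phi)\}$ (both $\sigma(\phi)$ and $\sigma[\phi]$ are ideal sets); $\phi^-(y)=\phi(y)$ if $\phi(y)$ has no gap below and $\phi^-(y)=\operatorname{pred}\phi(y)$ if $\phi(y)$ has a gap below. *)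

(* Defs.v *)
From HB Require Import structures.
From mathcomp Require Import all_boot all_order all_algebra.
From mathcomp Require Import all_classical all_reals all_analysis.

Set Implicit Arguments.
Unset Strict Implicit.
Unset Printing Implicit Defensive.

Import Order.TTheory GRing.Theory Num.Theory.
Import numFieldNormedType.Exports.

Local Open Scope classical_set_scope.
Local Open Scope ring_scope.

Definition partial_homeo_graph (X : topologicalType) (E : set (X * X)) : Prop :=
  exists (U V : set X) (f g : X -> X),
    [/\ clopen U /\ clopen V,
        {within U, continuous f} /\ {within V, continuous g},
        (forall x, U x -> V (f x) /\ g (f x) = x),
        (forall y, V y -> U (g y) /\ f (g y) = y) &
        E = [set p | U p.1 /\ p.2 = f p.1]].

Definition comp_rel (X : Type) (E F : set (X * X)) : set (X * X) :=
  [set p | exists z, E (p.1, z) /\ F (z, p.2)].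

Definition inv_rel (X : Type) (E : set (X * X)) : set (X * X) :=
  [set p | E (p.2, p.1)].

(* Matrix unit systems of unital AF algebras with canonical masa C(X), seen   *)
(* through the partial homeomorphisms of X that the matrix units induce.  The *)
(* n-th finite-dimensional algebra is the block-diagonal subalgebra of the    *)
(* matrices of size mu_size n in which r and s lie in the same simple summand *)
(* iff mu_block r = mu_block s; mu_graph r s is the graph of the partial      *)
(* homeomorphism induced by the matrix unit e_rs and has no meaning when r    *)
(* and s lie in different summands.                                           *)
(*   mu_diag, mu_part : the e_rr are projections of C(X) with sum 1;          *)
(*   mu_refine        : e_rs is a sum of matrix units of the next level;      *)
(*   mu_gen           : the projections e_rr generate C(X).                   *)
Record matrix_unit_system (X : topologicalType) := MatrixUnitSystem {
  mu_size : nat -> nat ;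
  mu_block : forall n, 'I_(mu_size n) -> nat ;
  mu_graph : forall n, 'I_(mu_size n) -> 'I_(mu_size n) -> set (X * X) ;
  mu_homeo : forall n (r s : 'I_(mu_size n)), mu_block r = mu_block s ->
    partial_homeo_graph (mu_graph r s) /\ mu_graph r s !=set0 ;
  mu_diag : forall n (r : 'I_(mu_size n)) p, mu_graph r r p -> p.1 = p.2 ;
  mu_part : forall n x, exists! r : 'I_(mu_size n), mu_graph r r (x, x) ;
  mu_inv : forall n (r s : 'I_(mu_size n)), mu_block r = mu_block s ->
    inv_rel (mu_graph r s) = mu_graph s r ;
  mu_comp : forall n (r s t : 'I_(mu_size n)),
    mu_block r = mu_block s -> mu_block s = mu_block t ->
    comp_rel (mu_graph r s) (mu_graph s t) = mu_graph r t ;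
  mu_refine : forall n (r s : 'I_(mu_size n)), mu_block r = mu_block s ->
    exists S : set ('I_(mu_size n.+1) * 'I_(mu_size n.+1)),
      (forall q, S q -> mu_block q.1 = mu_block q.2) /\
      mu_graph r s = \bigcup_(q in S) mu_graph q.1 q.2 ;
  mu_gen : forall (U : set X) x, open U -> U x ->
    exists n (r : 'I_(mu_size n)), mu_graph r r (x, x) /\
      [set z | mu_graph r r (z, z)] `<=` U
}.

Definition mu_graphs (X : topologicalType) (M : matrix_unit_system X) :
    set (set (X * X)) :=
  [set E | exists n (r s : 'I_(mu_size M n)),
    mu_block r = mu_block s /\ E = mu_graph r s].

(* The pairs of points of X, with the topology generated by the graphs of the *)
(* matrix units (not the product topology).  The groupoid is an open subset,  *)
(* and its own topology is the induced one.                                   *)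
Definition mu_pairs (X : topologicalType) (M : matrix_unit_system X) : Type :=
  (X * X)%type.

HB.instance Definition _ (X : topologicalType) (M : matrix_unit_system X) :=
  Choice.copy (mu_pairs M) (X * X)%type.

HB.instance Definition _ (X : topologicalType) (M : matrix_unit_system X) :=
  isSubBaseTopological.Build (mu_pairs M) (mu_graphs M)
    (fun E : set (X * X) => (E : set (mu_pairs M))).

Section Groupoid.
Variables (X : topologicalType) (M : matrix_unit_system X).

Definition groupoid : set (mu_pairs M) := \bigcup_(E in mu_graphs M) E.

Definition orb (y : X) : set X := [set x | groupoid (x, y)].

Definition G_set (N : set (mu_pairs M)) : Prop :=
  [/\ open N, N `<=` groupoid, set_inj N fst & set_inj N snd].

Definition G_neighborhood (p : mu_pairs M) (N : set (mu_pairs M)) : Prop :=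
  G_set N /\ N p.

Variables (R : realType) (b : X -> R).

Definition prece (x y : X) : Prop := b x <= b y.

Definition prec (x y : X) : Prop := b x < b y.

(* For A empty, this says that s is the minimum of X. *)
Definition is_supremum (A : set X) (s : X) : Prop :=
  (forall x, A x -> prece x s) /\
  (forall u, (forall x, A x -> prece x u) -> prece s u).

Definition is_pred (x y : X) : Prop :=
  prec x y /\ ~ exists z, prec x z /\ prec z y.

Definition gap_below (y : X) : Prop := exists x, is_pred x y.

Definition spectrum_P : set (mu_pairs M) :=
  [set p | groupoid p /\ prece p.1 p.2].

Definition ideal_set (sigma : set (mu_pairs M)) : Prop :=
  [/\ open sigma, sigma `<=` spectrum_P &
      forall w x y z, spectrum_P (w, x) -> spectrum_P (y, z) ->
        sigma (x, y) -> sigma (w, z)].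

(* phi is the boundary function phi_sigma of the ideal set sigma. *)
Definition is_boundary_function_of (sigma : set (mu_pairs M)) (phi : X -> X) :
    Prop :=
  ideal_set sigma /\
  forall y, is_supremum [set x | orb y x /\ sigma (x, y)] (phi y).

Record boundary_function (phi : X -> X) : Prop := BoundaryFunction {
  bf_le : forall y, prece (phi y) y ;
  bf_gap_P : forall y, gap_below (phi y) -> spectrum_P (phi y, y) ;
  bf_gap_gap : forall y, gap_below (phi y) -> gap_below y ;
  bf_gap_lt : forall y, gap_below (phi y) ->
    forall z, prec y z -> prec (phi y) (phi z) ;
  bf_gap_nbhs : forall y, gap_below (phi y) ->
    exists N, G_neighborhood (phi y, y) N /\
      forall s t, N (s, t) -> prece s (phi t) ;
  bf_mono : forall y z, prec y z -> prece (phi y) (phi z) ;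
  bf_sup : forall y, ~ gap_below y ->
    is_supremum [set phi t | t in [set t | prec t y]] (phi y)
}.

Definition sigma_paren (phi : X -> X) : set (mu_pairs M) :=
  [set p | spectrum_P p /\ prec p.1 (phi p.2)].

Definition eta (phi : X -> X) : set (mu_pairs M) :=
  [set p | spectrum_P p /\ prece p.1 (phi p.2)].

Definition sigma_brack (phi : X -> X) : set (mu_pairs M) :=
  [set p | spectrum_P p /\
    exists N, G_neighborhood p N /\ N `<=` eta phi].

(* The predecessor of phi y when it exists, and otherwise phi y. *)
Definition phi_minus (phi : X -> X) (y : X) : X :=
  xget (phi y) [set x | is_pred x (phi y)].

End Groupoid.

Arguments groupoid {X} M.
Arguments orb {X} M y.
Arguments spectrum_P {X} M {R} b.
Arguments ideal_set {X M R} b sigma.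
Arguments is_boundary_function_of {X M R} b sigma phi.
Arguments boundary_function {X} M {R} b phi.
Arguments sigma_paren {X} M {R} b phi.
Arguments eta {X} M {R} b phi.
Arguments sigma_brack {X} M {R} b phi.
Arguments phi_minus {X R} b phi y.

(* Main.v *)
Require Import Defs.
From HB Require Import structures.
From mathcomp Require Import all_boot all_order all_algebra.
From mathcomp Require Import finmap.
From mathcomp Require Import all_classical all_reals all_analysis.
Set Implicit Arguments.
Unset Strict Implicit.
Unset Printing Implicit Defensive.

Import Order.TTheory GRing.Theory Num.Theory.
Import numFieldNormedType.Exports.
Local Open Scope classical_set_scope.
Local Open Scope ring_scope.

(**
The topology of the groupoid is handled one level at a time.  The cell of p at
level n is the graph of the level-n matrix unit through p.  Matrix units of a
given level are pairwise disjoint and refine those of earlier levels, so the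
cells of p decrease, are nonempty from some level on, and form a base of
neighborhoods of p (near_cell_subset, open_near_cell).  They also compose: the
cell of (w, z) is the relational product of the cells of (w, x) and (x, z) at
the same level (cell_comp).  Openness, and the stability of open sets under
composition, thus become statements about all sufficiently large levels.

The set sigma_paren is open because x < phi y persists when x and y move
slightly (prec_phi_locally).  If y has a gap below, every t near y satisfies
y <= t, and phi is monotone; otherwise phi y is a supremum of values phi t0 with
t0 < y, and x < phi t0 for one of them.  Thus sigma_paren is an ideal set, and
it is contained in sigma_brack.  That sigma_brack is an ideal set follows from
the composition of cells and the monotonicity of phi.

For the suprema, fix y and suppose that u < z < phi y for some z.  The interval
from u to phi y is open and nonempty, so it meets the dense orbit of y, and u
is not an upper bound of the section of sigma_paren at y.  Such a z exists for
every u < phi y when phi y has no gap below, and z = pred (phi y) serves for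
every u < pred (phi y) when there is a gap.  This gives phi_minus for
sigma_paren.  For sigma_brack, the section at y is bounded by phi y; it contains
that of sigma_paren, which is enough when phi y has no gap below, and if phi y
has a gap then condition (2) on boundary functions puts (phi y, y) itself in
sigma_brack.
*)

(** * Matrix unit graphs as a neighborhood base of the groupoid *)

Section Cells.
Variables (X : topologicalType) (M : matrix_unit_system X).

Lemma mu_graph_diag n (r s : 'I_(mu_size M n)) x y :
  mu_block r = mu_block s -> mu_graph r s (x, y) ->
  mu_graph r r (x, x) /\ mu_graph s s (y, y).
Proof.
move=> rs Exy.
have Eyx : mu_graph s r (y, x) by rewrite -(mu_inv rs).
split; first by rewrite -(mu_comp rs (esym rs)); exists y.
by rewrite -(mu_comp (esym rs) rs); exists x.
Qed.

(** With mu_graph_diag, this shows that two matrix units of the same level whose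
    graphs meet are equal: both indices are determined by a common point. *)
Lemma mu_diag_unique n (r s : 'I_(mu_size M n)) x :
  mu_graph r r (x, x) -> mu_graph s s (x, x) -> r = s.
Proof. by have [t [_ tP]] := mu_part M n x => /tP <- /tP. Qed.

Definition cell n (p : mu_pairs M) : set (mu_pairs M) :=
  [set q | exists r s : 'I_(mu_size M n),
    [/\ mu_block r = mu_block s, mu_graph r s p & mu_graph r s q]].

(** The existential in the definition of a cell has at most one witness. *)
Lemma cell_graph n (r s : 'I_(mu_size M n)) (p : mu_pairs M) :
  mu_block r = mu_block s -> mu_graph r s p -> cell n p = mu_graph r s.
Proof.
case: p => x y rs Exy; apply/seteqP; split => [q [r' [s' [rs' E'xy E'q]]]|q Eq].
  have [rx sy] := mu_graph_diag rs Exy.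
  have [rx' sy'] := mu_graph_diag rs' E'xy.
  by rewrite (mu_diag_unique rx rx') (mu_diag_unique sy sy').
by exists r, s.
Qed.

Lemma cell_decr m n p : (m <= n)%N -> cell m p p ->
  cell n p p /\ cell n p `<=` cell m p.
Proof.
move=> /subnK <-; elim: (n - m)%N => [|k IHk] mp; first by split.
have [[r [s [rs Ep _]]] sub] := IHk mp.
have [S [Sblock ES]] := mu_refine rs.
have /= [[r' s'] Sq E'p] : (\bigcup_(q in S) mu_graph q.1 q.2) p by rewrite -ES.
have rs' : mu_block r' = mu_block s' := Sblock _ Sq.
split; first by exists r', s'.
apply: subset_trans sub.
rewrite (cell_graph rs' E'p) (cell_graph rs Ep) ES => q E'q.
by exists (r', s').
Qed.

Lemma near_cell p : groupoid M p -> \forall n \near \oo, cell n p p.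
Proof.
move=> [E [m [r [s [rs ->]]]] Ep]; exists m => // n /= mn.
have [] := @cell_decr m n p mn => //; by exists r, s.
Qed.

Lemma cell_groupoid n p : cell n p `<=` groupoid M.
Proof.
by move=> q [r [s [rs _ Eq]]]; exists (mu_graph r s) => //; exists n, r, s.
Qed.

Lemma open_mu_graph n (r s : 'I_(mu_size M n)) :
  mu_block r = mu_block s -> open (mu_graph r s : set (mu_pairs M)).
Proof.
move=> rs; set E : set (mu_pairs M) := mu_graph r s.
exists [set E]; last by rewrite bigcup_set1.
move=> _ ->; exists [fset (E : set (X * X))]%fset.
  by move=> F /fset1P ->; rewrite inE; exists n, r, s.
by rewrite set_fset1 bigcap_set1.
Qed.

Lemma cell_G_neighborhood n p : cell n p p -> G_neighborhood p (cell n p).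
Proof.
move=> pp; split=> //; have [r [s [rs Ep _]]] := pp.
have cE := cell_graph rs Ep.
have [[U [V [f [g [_ _ fP gP EE]]]]] _] := mu_homeo rs.
have {}cE : cell n p = [set p | U p.1 /\ p.2 = f p.1] by rewrite cE EE.
split.
- by rewrite (cell_graph rs Ep); exact: open_mu_graph.
- exact: cell_groupoid.
- move=> [x y] [x' y']; rewrite cE !inE /= => -[_ ->] [_ ->] xx'.
  by rewrite xx'.
- move=> [x y] [x' y']; rewrite cE !inE /= => -[Ux yE] [Ux' yE'] yy'.
  have -> : x = x'.
    by rewrite -(fP _ Ux).2 -(fP _ Ux').2 -yE -yE' yy'.
  by rewrite yy'.
Qed.

(** A subbasic open set around p is a cell of p at some level, hence contains all
    later cells of p; so does a finite intersection of such sets. *)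
Lemma near_cell_subset (N : set (mu_pairs M)) p :
  open N -> groupoid M p -> N p -> \forall n \near \oo, cell n p `<=` N.
Proof.
move=> [B BfinI <-] Gp [F /[dup] BF /BfinI[D DM FE] Fp].
have DN : forall E, E \in D -> \forall n \near \oo, cell n p `<=` E.
  move=> E ED; have := DM _ ED; rewrite inE => -[m [r [s [rs EE]]]].
  have Ep : E p by move: Fp; rewrite /= -FE => /(_ E); exact.
  exists m => // n /= mn; rewrite EE in Ep *; rewrite -(cell_graph rs Ep).
  have [] := @cell_decr m n p mn => //; by exists r, s.
apply: filterS (filter_bigI _ DN) => n sub q nq.
by exists F => //=; rewrite -FE => E ED; exact: sub nq.
Qed.

(** Converse of near_cell_subset, since each cell is itself open. *)
Lemma open_near_cell (S : set (mu_pairs M)) :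
  (forall p, S p -> groupoid M p /\ \forall n \near \oo, cell n p `<=` S) ->
  open S.
Proof.
move=> cellS; rewrite openE => p /cellS [Gp Sp].
have [n [pp sub]] : exists n, cell n p p /\ cell n p `<=` S.
  by apply: (@filter_ex _ \oo); apply: filterI => //; exact: near_cell.
have [[oc _ _ _] _] := cell_G_neighborhood pp.
by rewrite /interior nbhsE; exists (cell n p).
Qed.

(** The coordinate projections are continuous on the groupoid.  The projections
    e_rr generate the topology of X, and each coordinate of a point of the graph
    of e_rs lies in the diagonal graph of e_rr or e_ss. *)
Lemma near_cell_coord (U : set X) (p : mu_pairs M) : open U -> groupoid M p ->
  (U p.1 -> \forall n \near \oo, forall q, cell n p q -> U q.1) /\
  (U p.2 -> \forall n \near \oo, forall q, cell n p q -> U q.2).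
Proof.
move=> oU Gp.
have diagU x : U x -> exists m, forall n (r : 'I_(mu_size M n)) y, (m <= n)%N ->
    mu_graph r r (x, x) -> mu_graph r r (y, y) -> U y.
  move=> Ux; have [m [t [Ex subU]]] := mu_gen M oU Ux.
  exists m => n r y mn rx ry; apply: subU; rewrite /=.
  have mc : cell m (x, x) (x, x) by exists t, t.
  by rewrite -(cell_graph erefl Ex); apply: (cell_decr mn mc).2; exists r, r.
split=> /diagU[m mU]; exists m => // n /= mn [x' y'] [r [s [rs Ep Eq]]] /=.
  move: Ep; rewrite [p]surjective_pairing => /(mu_graph_diag rs)[Ep _].
  exact: mU mn Ep (mu_graph_diag rs Eq).1.
move: Ep; rewrite [p]surjective_pairing => /(mu_graph_diag rs)[_ Ep].
exact: mU mn Ep (mu_graph_diag rs Eq).2.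
Qed.

(** Cells at a common level are graphs of matrix units e_rs and e_st with the
    same middle index, whose product is e_rt. *)
Lemma cell_comp n w x z : cell n (w, x) (w, x) -> cell n (x, z) (x, z) ->
  cell n (w, z) = comp_rel (cell n (w, x)) (cell n (x, z)) /\
  cell n (w, z) (w, z).
Proof.
move=> [r [s [rs Ewx _]]] [s' [t [s't Exz _]]].
have ss' := mu_diag_unique (mu_graph_diag rs Ewx).2 (mu_graph_diag s't Exz).1.
rewrite -{}ss' in s't Exz.
have rt := etrans rs s't.
have Ewz : mu_graph r t (w, z) by rewrite -(mu_comp rs s't); exists x.
split; last by exists r, t.
by rewrite (cell_graph rs Ewx) (cell_graph s't Exz) (cell_graph rt Ewz) mu_comp.
Qed.

Lemma groupoid_trans w x z :
  groupoid M (w, x) -> groupoid M (x, z) -> groupoid M (w, z).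
Proof.
move=> /near_cell wx /near_cell xz.
have [n [nwx nxz]] := filter_ex (filterI wx xz).
exact: cell_groupoid (cell_comp nwx nxz).2.
Qed.

End Cells.

Arguments cell {X} M n p.

(** * The ideal sets attached to a boundary function *)

Section Order.
Variables (R : realType) (X : topologicalType) (M : matrix_unit_system X).
Variables (b : X -> R).
Hypotheses (b_cont : continuous b) (b_inj : injective b).

Lemma open_prec (c : R) : open [set x | b x < c] /\ open [set x | c < b x].
Proof.
split;
  [apply: (open_comp _ (@open_lt R c))|apply: (open_comp _ (@open_gt R c))];
  by move=> x _; exact: b_cont.
Qed.

Lemma near_cell_prec x y : groupoid M (x, y) ->
  (forall c, b x < c ->
    \forall n \near \oo, forall q, cell M n (x, y) q -> b q.1 < c) /\
  (forall c, c < b y ->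
    \forall n \near \oo, forall q, cell M n (x, y) q -> c < b q.2).
Proof.
move=> Gxy; split=> c cP.
  exact: (near_cell_coord (open_prec c).1 Gxy).1.
exact: (near_cell_coord (open_prec c).2 Gxy).2.
Qed.

(** The spectrum P is open: off the diagonal because b is continuous, and on
    the diagonal because the diagonal itself is open. *)
Lemma near_cell_spectrum_P p : spectrum_P M b p ->
  \forall n \near \oo, cell M n p `<=` spectrum_P M b.
Proof.
case: p => x y [Gxy]; rewrite /prece /= le_eqVlt => /orP[/eqP/b_inj xy|xy].
  rewrite -xy in Gxy *.
  apply: filterS (near_cell Gxy) => n [r [s [rs Exx _]]] q.
  have [rx sx] := mu_graph_diag rs Exx.
  have sr := mu_diag_unique sx rx; rewrite {}sr in rs Exx sx.
  move=> nq; split; first exact: cell_groupoid nq.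
  by move: nq; rewrite (cell_graph rs Exx) => /mu_diag; rewrite /prece => ->.
have [xc cy] := midf_lt xy.
have [/(_ _ xc) nx /(_ _ cy) ny] := near_cell_prec Gxy.
apply: filterS2 nx ny => n nx ny q nq; split; first exact: cell_groupoid nq.
exact: ltW (lt_trans (nx _ nq) (ny _ nq)).
Qed.

Variable phi : X -> X.
Hypothesis phi_bf : boundary_function M b phi.

Lemma phi_mono y z : b y <= b z -> b (phi y) <= b (phi z).
Proof.
rewrite le_eqVlt => /orP[/eqP/b_inj -> //|yz]; exact: (bf_mono phi_bf).
Qed.

(** The set of pairs with x < phi y is open for the order topology, although phi
    need not be continuous. *)
Lemma prec_phi_locally x y : b x < b (phi y) ->
  exists c d, [/\ b x < c, d < b y &
    forall s t, b s < c -> d < b t -> b s < b (phi t)].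
Proof.
move=> xy; have [[y' [y'y gap]]|nogap] := pselect (gap_below b y).
  (* Nothing lies strictly between y' = pred y and y, so y' < t forces y <= t. *)
  exists (b (phi y)), (b y'); split=> // s t sx ty.
  apply: lt_le_trans sx _; apply: phi_mono; rewrite leNgt; apply/negP => ty'.
  by apply: gap; exists t.
have [_ least] := bf_sup phi_bf nogap.
(* Here phi y is the supremum of phi below y, so some phi t0 exceeds x. *)
have [t0 t0y xt0] : exists2 t0, b t0 < b y & b x < b (phi t0).
  apply: contrapT => noT; move: xy; rewrite ltNge => /negP; apply.
  apply: least => _ [t ty <-]; rewrite /prece leNgt; apply/negP => xt.
  by apply: noT; exists t.
exists (b (phi t0)), (b t0); split=> // s t sx ty.
exact: lt_le_trans sx (phi_mono (ltW ty)).
Qed.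

Lemma ideal_set_sigma_paren : ideal_set b (sigma_paren M b phi).
Proof.
split.
- apply: open_near_cell => -[x y] [Pxy xy]; split; first exact: Pxy.1.
  have [c [d [xc dy lt_phi]]] := prec_phi_locally xy.
  have [/(_ _ xc) nx /(_ _ dy) ny] := near_cell_prec Pxy.1.
  apply: filterS3 nx ny (near_cell_spectrum_P Pxy) => n nx ny nP q nq.
  by split; [exact: nP|exact: lt_phi (nx _ nq) (ny _ nq)].
- by move=> p [].
- move=> w x y z [Gwx wx] [Gyz yz] [[Gxy xy] xphi]; split; first split.
  + exact: groupoid_trans Gwx (groupoid_trans Gxy Gyz).
  + exact: le_trans wx (le_trans xy yz).
  + exact: le_lt_trans wx (lt_le_trans xphi (phi_mono yz)).
Qed.

(** A neighborhood of (w, z) in eta is the product of cells of (w, x), (x, y) and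
    (y, z) at one level, taken in P, eta and P respectively: along a chain
    w' <= x' <= phi y' with y' <= z' the bound w' <= phi z' survives. *)
Lemma ideal_set_sigma_brack : ideal_set b (sigma_brack M b phi).
Proof.
(* In terms of cells, sigma_brack is the interior of eta: brackP and near_eta. *)
have brackP p : groupoid M p ->
    (\forall n \near \oo, cell M n p `<=` Defs.eta M b phi) ->
    sigma_brack M b phi p.
  move=> Gp /(filterI (near_cell Gp))/filter_ex[n [pp sub]].
  split; first exact: (sub _ pp).1.
  by exists (cell M n p); split=> //; exact: cell_G_neighborhood.
have near_eta p : sigma_brack M b phi p ->
    \forall n \near \oo, cell M n p `<=` Defs.eta M b phi.
  move=> [Pp [N [[[oN _ _ _] Np] sub]]].
  apply: filterS (near_cell_subset oN Pp.1 Np) => n nN.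
  exact: subset_trans nN sub.
split.
- apply: open_near_cell => p Sp; split; first exact: Sp.1.1.
  have [n [pp sub]] := filter_ex (filterI (near_cell Sp.1.1) (near_eta p Sp)).
  have [oN pN] := cell_G_neighborhood pp.
  have [oc _ _ _] := oN.
  apply: filterS (near_cell_subset oc Sp.1.1 pp) => m mn q mq.
  split; first exact: (sub _ (mn _ mq)).1.
  by exists (cell M n p); split=> //; split=> //; exact: mn.
- by move=> p [].
- move=> w x y z Pwx Pyz Sxy; have Gxy := Sxy.1.1.
  have Gxz := groupoid_trans Gxy Pyz.1.
  apply: brackP; first exact: groupoid_trans Pwx.1 Gxz.
  near=> n.
  have wx : cell M n (w, x) (w, x) by near: n; exact: near_cell Pwx.1.
  have xy : cell M n (x, y) (x, y) by near: n; exact: near_cell.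
  have yz : cell M n (y, z) (y, z) by near: n; exact: near_cell Pyz.1.
  have [xzE xz] := cell_comp xy yz.
  rewrite (cell_comp wx xz).1 xzE => -[w' z'] [x' [/= wx' [y' [/= xy' yz']]]].
  have Pwx' : spectrum_P M b (w', x').
    by apply: (near (near_cell_spectrum_P Pwx) n).
  have [Pxy' xphi] : Defs.eta M b phi (x', y').
    by apply: (near (near_eta _ Sxy) n).
  have Pyz' : spectrum_P M b (y', z').
    by apply: (near (near_cell_spectrum_P Pyz) n).
  split; first split.
  + exact: groupoid_trans Pwx'.1 (groupoid_trans Pxy'.1 Pyz'.1).
  + exact: le_trans Pwx'.2 (le_trans Pxy'.2 Pyz'.2).
  + exact: le_trans Pwx'.2 (le_trans xphi (phi_mono Pyz'.2)).
Unshelve. all: by end_near.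
Qed.

Lemma sigma_paren_subset : sigma_paren M b phi `<=` sigma_brack M b phi.
Proof.
have [oS _ _] := ideal_set_sigma_paren.
move=> p Sp; split; first exact: Sp.1.
have near_sub := near_cell_subset oS Sp.1.1 Sp.
have [n [pp sub]] := filter_ex (filterI (near_cell Sp.1.1) near_sub).
exists (cell M n p); split; first exact: cell_G_neighborhood.
by move=> q /sub [Pq /ltW].
Qed.

Hypothesis orb_dense : forall y, dense (orb M y).

(** The order interval from u to phi y is open, and nonempty thanks to z, so it
    contains a point of the dense orbit of y. *)
Lemma sigma_paren_section y z u : b u < b z -> b z < b (phi y) ->
  exists2 x, b u < b x & orb M y x /\ sigma_paren M b phi (x, y).
Proof.
move=> uz zphi.
have oI := openI (open_prec (b u)).2 (open_prec (b (phi y))).1.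
have [|x [[/= ux xphi] Gxy]] := orb_dense y _ oI; first by exists z.
exists x => //; split=> //; split=> //; split=> //.
exact: ltW (lt_le_trans xphi (bf_le phi_bf y)).
Qed.

(** An upper bound u < phi y would be the predecessor of phi y. *)
Lemma sup_sigma_paren_no_gap y : ~ gap_below b (phi y) ->
  is_supremum b [set x | orb M y x /\ sigma_paren M b phi (x, y)] (phi y).
Proof.
move=> nogap; split=> [x [_ [_ /ltW]] //|u ub].
rewrite /prece leNgt; apply/negP => uphi; apply: nogap.
exists u; split=> // -[z [uz zphi]].
have [x ux /ub] := sigma_paren_section uz zphi.
by rewrite /prece leNgt ux.
Qed.

(** No u < q is an upper bound, as q itself witnesses that the interval from u
    to phi y is nonempty; q may fail to be in the orbit of y. *)
Lemma sup_sigma_paren_pred y q : is_pred b q (phi y) ->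
  is_supremum b [set x | orb M y x /\ sigma_paren M b phi (x, y)] q.
Proof.
move=> [qphi gap]; split=> [x [_ [_ xphi]]|u ub].
  by rewrite /prece leNgt; apply/negP => qx; apply: gap; exists x.
rewrite /prece leNgt; apply/negP => uq.
have [x ux /ub] := sigma_paren_section uq qphi.
by rewrite /prece leNgt ux.
Qed.

(** This is where the conditions on phi at a gap below phi y are used: they say
    that (phi y, y) is in P with a neighborhood contained in eta. *)
Lemma gap_sigma_brack y : gap_below b (phi y) ->
  sigma_brack M b phi (phi y, y).
Proof.
move=> gap; split; first exact: (bf_gap_P phi_bf).
have [N [[GN Np] sub]] := bf_gap_nbhs phi_bf gap.
exists N; split=> // -[s t] Nst; have st := sub _ _ Nst.
split=> //; split; first by have [_ NG _ _] := GN; exact: NG.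
exact: le_trans st (bf_le phi_bf t).
Qed.

End Order.

Theorem proposition6 (R : realType) (X : topologicalType)
  (X_cantor : cantor_like X)
  (M : matrix_unit_system X)
  (M_simple : forall y : X, dense (orb M y))
  (b : X -> R) (b_cont : continuous b) (b_inj : injective b)
  (phi : X -> X) (phi_bf : boundary_function M b phi) :
  is_boundary_function_of b (sigma_brack M b phi) phi /\
  is_boundary_function_of b (sigma_paren M b phi) (phi_minus b phi).
Proof.
split; split;
  [exact: ideal_set_sigma_brack| |exact: ideal_set_sigma_paren|] => y.
  have [gap|nogap] := pselect (gap_below b (phi y)).
    split=> [x [_ [_ [N [[_ Np] /(_ _ Np)[]]]]] //|u]; apply; split.
      by have [] := bf_gap_P phi_bf gap.
    exact: gap_sigma_brack.
  (* The section of sigma_brack contains that of sigma_paren, whose supremum is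
     already phi y. *)
  split=> [x [_ [_ [N [[_ Np] /(_ _ Np)[]]]]] //|u ub].
  apply: (sup_sigma_paren_no_gap b_cont phi_bf M_simple nogap).2 => x [Gxy Sxy].
  by apply: ub; split=> //; exact: sigma_paren_subset.
rewrite /phi_minus; case: xgetP => [q _ /= pred_q|nopred].
  exact: sup_sigma_paren_pred.
by apply: sup_sigma_paren_no_gap => // -[q /nopred].
Qed.
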